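(* Let $n\ge 2$ and $k\ge 1$ be integers and define $$A_{n,k}:=\{a\in(\mathbb{Z}/n\mathbb{Z})^\times : a^k\in\{\pm1\}\}.$$ Then $A_{n,k}$ is a subgroup of $(\mathbb{Z}/n\mathbb{Z})^\times$. Moreover, the map $$\varphi: A_{n,k}\longrightarrow\{\pm1\},\qquad a\mapsto a^k,$$ is a group homomorphism whose image is a subgroup of $\{\pm1\}$ (hence either $\{1\}$ or $\{\pm1\}$), and its kernel is $\{a\in A_{n,k}: a^k=1\}$.
   Context: Here $\{\pm 1\}$ denotes the subgroup of $(\mathbb{Z}/n\mathbb{Z})^\times$ consisting of the residue classes of $1$ and $-1$. *)

(* Defs.v *)
From mathcomp Require Import all_boot all_algebra all_fingroup.

Set Implicit Arguments.
Unset Strict Implicit.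
Unset Printing Implicit Defensive.

Import GroupScope GRing.Theory.

(* For n >= 2, {unit 'Z_n} is (Z/nZ)^* as a type, and units_Zp n is the full
   group on it. *)

Definition pm1 (n : nat) : {set {unit 'Z_n}} :=
  [set u | (val u == 1%R) || (val u == (-1)%R)].

Lemma pm1_group_set (n : nat) : group_set (pm1 n).
Proof.
apply/group_setP; split=> [|u v]; rewrite !inE ?val_unit1 ?eqxx //.
move=> /orP[]/eqP hu /orP[]/eqP hv; rewrite FinRing.val_unitM hu hv.
- by rewrite mulr1 eqxx.
- by rewrite mul1r eqxx orbT.
- by rewrite mulr1 eqxx orbT.
- by rewrite mulrNN mulr1 eqxx.
Qed.

Canonical pm1_group (n : nat) : {group {unit 'Z_n}} := Group (pm1_group_set n).

Definition A_ (n k : nat) : {set {unit 'Z_n}} :=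
  [set a in units_Zp n | a ^+ k \in pm1 n].

(* Main.v *)
Require Import Defs.
From mathcomp Require Import all_boot all_algebra all_fingroup.

Import GroupScope.

(** The unit group of ['Z_n] is abelian, so [a ^+ k] is multiplicative in [a]. Hence [A_ n k], the
    preimage of the subgroup [pm1 n] under this endomorphism, is a subgroup, and [phi] is the
    restriction to it. The image of [phi] is then a subgroup of [pm1 n], which [subgroup_pm1]
    classifies. *)

Lemma expgMn_unit_Zp (n k : nat) :
  {morph (fun a : {unit 'Z_n} => a ^+ k) : a b / a * b}.
Proof. by move=> a b; apply: expgMn; apply: unit_Zp_mulgC. Qed.

Lemma A_group_set (n k : nat) : group_set (A_ n k).
Proof.
apply/group_setP; split=> [|a b]; rewrite !inE ?expg1n /= ?eqxx //.
move=> ha hb; have := @groupM _ (pm1_group n) (a ^+ k) (b ^+ k).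
by rewrite expgMn_unit_Zp !inE; apply.
Qed.

Canonical A_group (n k : nat) : {group {unit 'Z_n}} := Group (A_group_set n k).

(** A nontrivial element of [G] can only be the class of -1, and together with 1 it exhausts
    [pm1 n]. If -1 = 1, the two alternatives coincide. *)
Lemma subgroup_pm1 (n : nat) (G : {group {unit 'Z_n}}) :
  G \subset pm1 n -> G :=: 1 \/ G :=: pm1 n.
Proof.
move=> sGpm; have [->|/trivgPn[x Gx ntx]] := eqVneq (G : {set _}) 1; first by left.
right; apply/eqP; rewrite eqEsubset sGpm; apply/subsetP=> y.
have := subsetP sGpm x Gx; rewrite !inE.
case/orP=> /eqP xE; first by case/eqP: ntx; apply: val_inj.
case/orP=> /eqP yE.
  by rewrite (_ : y = 1) ?group1 //; apply: val_inj.
by rewrite (_ : y = x) //; apply: val_inj; rewrite xE.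
Qed.

Theorem proposition2p10 (n k : nat) (hn : (2 <= n)%N) (hk : (1 <= k)%N) :
  (A_ n k \subset units_Zp n /\ group_set (A_ n k)) /\
  exists phi : {morphism A_ n k >-> {unit 'Z_n}},
    [/\ {in A_ n k, forall a, phi a = a ^+ k},
        phi @* A_ n k \subset pm1 n /\ group_set (phi @* A_ n k),
        phi @* A_ n k = [set 1] \/ phi @* A_ n k = pm1 n
      & 'ker phi = [set a in A_ n k | a ^+ k == 1]].
Proof.
split; first by split; [apply: subsetT | apply: A_group_set].
(* Powering is multiplicative on all units; [in2W] weakens this to the domain [A_ n k]. *)
pose phi : {morphism A_ n k >-> {unit 'Z_n}} :=
  Morphism (D := A_ n k) (in2W (@expgMn_unit_Zp n k)).
have sim : phi @* A_ n k \subset pm1 n.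
  by apply/subsetP=> _ /morphimP[a _ + ->]; rewrite inE => /andP[_].
have gim : group_set (phi @* A_ n k).
  exact: (morphim_groupset phi (A_group n k)).
exists phi; split=> //; first exact: (@subgroup_pm1 n (Group gim)).
(* The kernel is by definition the part of the domain sent to 1. *)
by apply/setP=> a; rewrite !inE.
Qed.
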